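(* Every uncapacitated flow-based extension (or, equivalently, every $s$--$t$ path extension) of the perfect matching polytope $P_{\mathrm{perfect\ matching}}(K_{n,n})$ of the complete bipartite graph $K_{n,n}$ has size $\Omega\left(\frac{2^{n}}{\sqrt{n}}\right)$. That is, there is an absolute constant $C>0$ such that for all sufficiently large positive integers $n$, every such extension has size at least $C\,\frac{2^{n}}{\sqrt{n}}$.
   Context: Perfect matching polytope: a perfect matching of an undirected graph $G=(V(G),E(G))$ is a set of edges $M\subseteq E(G)$ such that every vertex of $G$ is incident to exactly one edge of $M$. $P_{\mathrm{perfect\ matching}}(G)=\operatorname{conv}\{\chi^M\in\mathbb{R}^{E(G)} : M \text{ perfect matching of } G\}$, where $\chi^M$ is the incidence (0/1 characteristic) vector of $M$. Networks and flows: an uncapacitated network $N=(V,A)$ is a finite directed graph (parallel arcs allowed) with a source $s\in V$ and a sink $t\in V\setminus\{s\}$. For $v\in V$, $\delta^+(v)$ and $\delta^-(v)$ denote the sets of arcs leaving and entering $v$, and $\phi(B):=\sum_{a\in B}\phi_a$ for $\phi\in\mathbb{R}^A$, $B\subseteq A$. For a flow value $k>0$, the (uncapacitated) flow polyhedron is $$Q=\{\phi\in\mathbb{R}^A : \phi(\delta^+(v))-\phi(\delta^-(v))=0\ \forall v\in V\setminus\{s,t\},\ \phi(\delta^+(s))-\phi(\delta^-(s))=k,\ \phi\geqslant 0\}.$$ $Q$ is an uncapacitated flow-based extension of a polytope $P\subseteq\mathbb{R}^d$ if there is a linear map $\pi:\mathbb{R}^A\to\mathbb{R}^d$ with $\pi(Q)=P$.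 Its size is the number of arcs $|A|$ of the network. If $N$ is acyclic and $k=1$, then $Q$ is the convex hull of the characteristic vectors $\chi^\sigma\in\mathbb{R}^A$ of the directed $s$--$t$ paths $\sigma$ in $N$; in this case the extension is called an $s$--$t$ path extension. *)

(* Defs.v *)
From HB Require Import structures.
From mathcomp Require Import all_boot all_order all_algebra.
From mathcomp Require Import boolp classical_sets reals convex.

Set Implicit Arguments.
Unset Strict Implicit.
Unset Printing Implicit Defensive.

Import Order.TTheory GRing.Theory Num.Theory.

Local Open Scope classical_set_scope.
Local Open Scope ring_scope.

Definition convex_hull (R : realType) (V : lmodType R) (X : set V) : set V :=
  smallest (@convex_set R V) X.

Record graph := Graph {
  vertex : finType;
  adj : rel vertex;
  adj_sym : symmetric adj;
  adj_irr : irreflexive adj }.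

Definition edge_set (G : graph) : {set {set vertex G}} :=
  [set [set p.1; p.2] | p : vertex G * vertex G & adj p.1 p.2]%SET.

Definition edge (G : graph) : finType := {e : {set vertex G} | e \in edge_set G}.

Definition perfect_matching (G : graph) (M : {set edge G}) : Prop :=
  forall v : vertex G, #|[set e in M | v \in val e]%SET| = 1%N.

Definition incidence (R : realType) (I : finType) (B : {set I}) :
    {ffun I -> R^o} :=
  [ffun i => (i \in B)%:R].

Definition perfect_matching_polytope (R : realType) (G : graph) :
    set {ffun edge G -> R^o} :=
  convex_hull [set incidence R M | M in @perfect_matching G].

Arguments perfect_matching_polytope : clear implicits.

Definition Knn_adj (n : nat) : rel ('I_n + 'I_n) :=
  fun u v => is_inl u != is_inl v.

Lemma Knn_adj_sym n : symmetric (@Knn_adj n).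
Proof. by move=> u v; rewrite /Knn_adj eq_sym. Qed.

Lemma Knn_adj_irr n : irreflexive (@Knn_adj n).
Proof. by move=> u; rewrite /Knn_adj eqxx. Qed.

Definition Knn (n : nat) : graph := Graph (@Knn_adj_sym n) (@Knn_adj_irr n).

(* Arcs form a type of their own, so parallel arcs are allowed; loops are not
   excluded either. *)
Record network := Network {
  node : finType;
  arc : finType;
  arc_tail : arc -> node;
  arc_head : arc -> node;
  source : node;
  sink : node;
  sink_neq_source : sink != source }.

Definition network_size (N : network) : nat := #|arc N|.

Definition leaving (N : network) (v : node N) : {set arc N} :=
  [set a | arc_tail a == v]%SET.

Definition entering (N : network) (v : node N) : {set arc N} :=
  [set a | arc_head a == v]%SET.

Definition flow_sum (R : realType) (I : finType) (phi : {ffun I -> R^o})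
    (B : {set I}) : R :=
  \sum_(i in B) phi i.

(* Conservation is not imposed at the sink: there it follows that the net
   outflow is [- k]. *)
Definition flow_polyhedron (R : realType) (N : network) (k : R) :
    set {ffun arc N -> R^o} :=
  [set phi | [/\
    forall v : node N, v != source N -> v != sink N ->
      flow_sum phi (leaving v) - flow_sum phi (entering v) = 0,
    flow_sum phi (leaving (source N)) - flow_sum phi (entering (source N)) = k &
    forall a : arc N, 0 <= phi a :> R]].

Arguments flow_polyhedron {R} N k.

Definition acyclic (N : network) : Prop :=
  forall c : seq (node N),
    ucycle (fun u v => [exists a : arc N, (arc_tail a == u) && (arc_head a == v)]) c ->
    c = [::].

Definition flow_extension (R : realType) (I : finType) (N : network) (k : R)
    (P : set {ffun I -> R^o}) : Prop :=
  0 < k /\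
  exists pi : {linear {ffun arc N -> R^o} -> {ffun I -> R^o}},
    pi @` flow_polyhedron N k = P.

Definition path_extension (R : realType) (I : finType) (N : network)
    (P : set {ffun I -> R^o}) : Prop :=
  acyclic N /\ flow_extension N 1 P.

(* Main.v *)
(* The weight of an arc is the image under the projection of a flow of value k
   on that arc alone, so the total weight of every walk from the source to the
   sink is a point of the polytope; and the support of a flow over the vertex of
   a permutation s contains such a walk, of weight zero off the graph of s.
   Subtracting shortest-walk potentials coordinatewise makes the weights of
   these arcs nonnegative and changes no total weight.  The row and column sums
   of the reduced weight collected so far depend only on the current node, so a
   node determines the rows and the columns already touched; on the walk of s
   both sets grow from empty to full and s maps one onto the other.  On the
   first arc after which at least h rows have been touched, the rows touched by
   the arc itself have a prescribed image, hence at most (h-1)! (n-h)!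
   permutations choose a given arc, and there are at least
   n! / ((h-1)! (n-h)!) = h C(n,h) arcs. *)
From Pilot Require Import Defs.
From HB Require Import structures.
From mathcomp Require Import all_boot all_order all_algebra.
From mathcomp Require Import boolp classical_sets reals convex.
From mathcomp Require Import interval_inference all_fingroup zify ring lra.
(* [path.arc] would otherwise hide the arcs of a network. *)
Import Pilot.Defs.

Set Implicit Arguments.
Unset Strict Implicit.
Unset Printing Implicit Defensive.

Import Order.TTheory GRing.Theory Num.Theory.

Local Open Scope ring_scope.

(** * Counting permutations, and a factorial estimate *)

(** Right translation by the inverse of one member [t] sends [F] injectively to permutations that
    stabilise [A] and [B] and fix all other points, that is, into the product of the symmetric
    groups of [A] and [B]. *)
Lemma card_perms_prescribed (T : finType) (A B A' B' : {set T})
    (F : {set {perm T}}) :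
  [disjoint A & B] ->
  {in F, forall (s : {perm T}) x, (s x \in A') = (x \in A)} ->
  {in F, forall (s : {perm T}) x, (s x \in B') = (x \in B)} ->
  {in F &, forall (s t : {perm T}) x, x \notin A -> x \notin B -> s x = t x} ->
  (#|F| <= (#|A|)`! * (#|B|)`!)%N.
Proof.
move=> dAB FA FB Fout.
have [->|[t Ft]] := set_0Vmem F; first by rewrite cards0.
rewrite -!card_Sym mul_cardG; apply: leq_trans (leq_pmulr _ (cardG_gt0 _)).
rewrite -(card_imset _ (mulIg t^-1%g)); apply/subset_leq_card/fintype.subsetP.
move=> _ /imsetP[s Fs ->]; set r := (s * t^-1)%g.
have rE x : t (r x) = s x by rewrite permM permKV.
have rA x : (r x \in A) = (x \in A) by rewrite -(FA t Ft) rE FA.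
have rB x : (r x \in B) = (x \in B) by rewrite -(FB t Ft) rE FB.
have rN x : x \notin A -> x \notin B -> r x = x.
  by move=> xA xB; apply: (@perm_inj _ t); rewrite rE; apply: Fout.
have nA : r \in 'N(A | 'P)%g by apply/astabsP => x; rewrite /= apermE.
have nB : r \in 'N(B | 'P)%g by apply/astabsP => x; rewrite /= apermE.
have -> : r = (restr_perm A r * restr_perm B r)%g.
  apply/permP => x; rewrite permM.
  have [xA|xA] := boolP (x \in A).
    rewrite (restr_permE nA xA) (out_perm (restr_perm_on B r)) //.
    by rewrite (disjointFr dAB) // rA.
  rewrite (out_perm (restr_perm_on A r) xA).
  have [xB|xB] := boolP (x \in B); first by rewrite (restr_permE nB xB).
  by rewrite (out_perm (restr_perm_on B r) xB) rN.
by rewrite mem_mulg // inE restr_perm_on.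
Qed.

(** Induction in steps of two: the left side gains the factor 4(a+1)(b+1), the right side
    (n+3)(n+2), where a + b = n and a is b or b + 1. *)
Lemma leq_exp2_fact (n : nat) :
  (2 ^ n.+1 * ((n.+1 %/ 2)`! * (n %/ 2)`!) <= 4 * n.+1`!)%N.
Proof.
elim/ltn_ind: n => -[_ //|[_ //|n]] IH.
have {IH} := IH n (ltnW (ltnSn _)).
have -> : (n.+3 %/ 2 = (n.+1 %/ 2).+1)%N by lia.
have -> : (n.+2 %/ 2 = (n %/ 2).+1)%N by lia.
have -> : (2 ^ n.+3 = 2 ^ 2 * 2 ^ n.+1)%N by rewrite -expnD.
rewrite (factS n.+2) (factS n.+1) !(factS (_ %/ _)).
set a := (n.+1 %/ 2)%N; set b := (n %/ 2)%N; set x := (2 ^ _)%N.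
move: (a`!) (b`!) (n.+1`!) => fa fb fn H.
have ab : (2 ^ 2 * (a.+1 * b.+1) <= n.+3 * n.+2)%N.
  have -> : n = (a + b)%N by rewrite /a /b; lia.
  have : (a = b \/ a = b.+1)%N by rewrite /a /b; lia.
  by case=> ->; nia.
have := leq_mul ab H; nia.
Qed.

(** * Walks in a network and shortest-walk potentials *)

Section Walks.
Variable N : network.
Implicit Types (u v : node N) (a : arc N) (p q : seq (arc N)).

Fixpoint walk u v p : bool :=
  if p is a :: q then (arc_tail a == u) && walk (arc_head a) v q else u == v.

Lemma walk_cat u v p q :
  walk u v (p ++ q) <-> exists2 x, walk u x p & walk x v q.
Proof.
elim: p u => [|a p IH] u /=.
  by split=> [wq|[x /eqP-> //]]; exists u.
split=> [/andP[-> /IH[x ? ?]]|[x /andP[-> ?] ?]]; first by exists x.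
by apply/IH; exists x.
Qed.

Lemma walk_split u v p a : walk u v p -> a \in p ->
  exists p1 p2, walk u (arc_tail a) p1 /\ walk (arc_head a) v p2.
Proof.
move=> wp ap; move: ap wp => /splitPr[p1 p2] /walk_cat[x wp1 /= /andP[/eqP ax wp2]].
by exists p1, p2; rewrite ax.
Qed.

Lemma walk_first u v p (P : pred (node N)) : walk u v p -> ~~ P u -> P v ->
  exists2 a, a \in p & ~~ P (arc_tail a) && P (arc_head a).
Proof.
elim: p u => [|a p IH] u /=; first by move/eqP=> -> /negP nP /nP.
case/andP=> /eqP au wp Pu Pv; have [Pa|Pa] := boolP (P (arc_head a)).
  by exists a; rewrite ?mem_head // au Pu.
by have [b bp Pb] := IH _ wp Pa Pv; exists b => //; rewrite inE bp orbT.
Qed.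

Lemma walk_ind u v p (P : node N -> Prop) : walk u v p -> P u ->
  {in p, forall a, P (arc_tail a) -> P (arc_head a)} ->
  {in p, forall a, P (arc_tail a) /\ P (arc_head a)}.
Proof.
elim: p u => [|a p IH] u //= /andP[/eqP au wp] Pu step.
have Pa : P (arc_tail a) by rewrite au.
have Ph : P (arc_head a) by apply: step; rewrite ?mem_head.
move=> b; rewrite inE => /predU1P[-> //|bp].
by apply: (IH _ wp Ph) => // c cp; apply: step; rewrite inE cp orbT.
Qed.

Variable R : realType.
Implicit Type w : arc N -> R.

Lemma walk_telescope (f : node N -> R) u v p : walk u v p ->
  \sum_(a <- p) (f (arc_head a) - f (arc_tail a)) = f v - f u.
Proof.
elim: p u => [|a p IH] u /=; first by move/eqP->; rewrite big_nil subrr.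
by case/andP=> /eqP <- /IH e; rewrite big_cons e; ring.
Qed.

(* The infimum is finite at the nodes lying on some walk from the source to
   the sink, provided that the weights of those walks are bounded below; elsewhere its
   value is irrelevant. *)
Definition potential w v : R :=
  inf [set x | exists2 p, walk (source N) v p & \sum_(a <- p) w a = x]%classic.

(** Every walk to [v] can be completed by [q], so its weight is at least [c] minus the weight of
    [q]; hence the infimum is over a set bounded below. *)
Lemma potential_le w c v p q :
  (forall p, walk (source N) (sink N) p -> c <= \sum_(a <- p) w a) ->
  walk (source N) v p -> walk v (sink N) q -> potential w v <= \sum_(a <- p) w a.
Proof.
move=> wc wp wq; apply: ge_inf; last by exists p.
exists (c - \sum_(a <- q) w a) => _ [p' wp' <-].
have /wc : walk (source N) (sink N) (p' ++ q) by apply/walk_cat; exists v.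
by rewrite big_cat /= lerBlDr.
Qed.

Lemma le_potential w c v p : walk (source N) v p ->
  (forall p, walk (source N) v p -> c <= \sum_(a <- p) w a) -> c <= potential w v.
Proof.
move=> wp wc; apply: lb_le_inf; first by exists (\sum_(a <- p) w a), p.
by move=> _ [q wq <-]; apply: wc.
Qed.

(** Appending [a] to any walk to its tail gives a walk to its head. Membership of [a] in [p] makes
    the potentials at both ends genuine infima. *)
Lemma potential_arc w c p a :
  (forall p, walk (source N) (sink N) p -> c <= \sum_(a <- p) w a) ->
  walk (source N) (sink N) p -> a \in p ->
  0 <= w a - (potential w (arc_head a) - potential w (arc_tail a)).
Proof.
move=> wc wp /(walk_split wp)[p1 [p2 [wp1 wp2]]].
suff : potential w (arc_head a) - w a <= potential w (arc_tail a) by lra.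
apply: (le_potential wp1) => q wq.
have /(potential_le wc) : walk (source N) (arc_head a) (q ++ [:: a]).
  by apply/walk_cat; exists (arc_tail a); rewrite //= !eqxx.
by move/(_ _ wp2); rewrite big_cat /= big_seq1 lerBlDr.
Qed.

(* A walk of minimal weight [c] has nonnegative reduced costs of nonpositive
   sum, so they all vanish. *)
Lemma potential_tight w c p :
  (forall p, walk (source N) (sink N) p -> c <= \sum_(a <- p) w a) ->
  walk (source N) (sink N) p -> \sum_(a <- p) w a = c ->
  [/\ potential w (source N) = 0, potential w (sink N) = c &
    {in p, forall a, w a = potential w (arc_head a) - potential w (arc_tail a)}].
Proof.
move=> wc wp pc.
have s0 : potential w (source N) <= 0.
  by have := @potential_le w c _ [::] p wc (eqxx _) wp; rewrite big_nil.
have tc : c <= potential w (sink N) by apply: le_potential wp wc.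
have pos a : a \in p -> true ->
    0 <= w a - (potential w (arc_head a) - potential w (arc_tail a)).
  by move=> ap _; apply: potential_arc wc wp ap.
have E : \sum_(a <- p) (w a - (potential w (arc_head a) - potential w (arc_tail a)))
    = c - potential w (sink N) + potential w (source N).
  by rewrite sumrB (walk_telescope _ wp) pc; ring.
have ge0 : 0 <= c - potential w (sink N) + potential w (source N).
  by rewrite -E big_seq; apply: sumr_ge0 => a ap; apply: pos.
split; [lra|lra|] => a ap.
have /eqP : \sum_(a <- p) (w a - (potential w (arc_head a) - potential w (arc_tail a)))
    = 0 by rewrite E; lra.
rewrite big_seq psumr_eq0 => [|b bp]; last exact: pos.
by move/allP/(_ a ap); rewrite ap /= subr_eq0 => /eqP.
Qed.

End Walks.

(** * Touched rows and columns, and the number of permutations per arc *)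

Section Counting.
Variables (R : realType) (N : network) (n : nat).
Variable w : arc N -> 'I_n -> 'I_n -> R.

Hypothesis n_gt1 : (1 < n)%N.
Hypothesis walk_ge0 : forall p, walk (source N) (sink N) p ->
  forall i j, 0 <= \sum_(a <- p) w a i j.
Hypothesis walk_row : forall p, walk (source N) (sink N) p ->
  forall i, \sum_(a <- p) \sum_j w a i j = 1.
Hypothesis walk_col : forall p, walk (source N) (sink N) p ->
  forall j, \sum_(a <- p) \sum_i w a i j = 1.
Hypothesis walk_perm : forall s : {perm 'I_n},
  exists2 p, walk (source N) (sink N) p &
    forall i j, j != s i -> \sum_(a <- p) w a i j = 0.

Let y i j := potential (fun a => w a i j).
Let reduced a i j := w a i j - (y i j (arc_head a) - y i j (arc_tail a)).
(** All source-sink walks have the same weight in row [i], so the weight collected up to a node on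
    such a walk is a potential; subtracting the [y i j] leaves the collected row sum of
    [reduced]. *)
Let row i v := potential (fun a => \sum_j w a i j) v - \sum_j y i j v.
Let col j v := potential (fun a => \sum_i w a i j) v - \sum_i y i j v.

Lemma reduced_ge0 p a i j :
  walk (source N) (sink N) p -> a \in p -> 0 <= reduced a i j.
Proof.
move=> wp ap; apply: (@potential_arc _ _ _ 0) wp ap => q wq.
exact: walk_ge0.
Qed.

Lemma reduced_eq0 p i j : walk (source N) (sink N) p ->
  \sum_(a <- p) w a i j = 0 ->
  [/\ y i j (source N) = 0, y i j (sink N) = 0 &
    {in p, forall a, reduced a i j = 0}].
Proof.
move=> wp p0; have [|s0 t0 tight] := potential_tight _ wp p0.
  by move=> q wq; apply: walk_ge0.
by split=> // a ap; rewrite /reduced tight // subrr.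
Qed.

(** This uses [1 < n]. It gives for each entry a source-sink walk of weight 0 there, which forces
    [y i j] to vanish at both source and sink. *)
Lemma perm_avoiding (i j : 'I_n) : exists s : {perm 'I_n}, j != s i.
Proof.
have [k kj] : exists k : 'I_n, k != j.
  have : (0 < #|[set~ j]|)%N by rewrite cardsC1 card_ord; lia.
  by case/card_gt0P => k; rewrite !inE; exists k.
by exists (tperm i k); rewrite tpermL eq_sym.
Qed.

Lemma y_source i j : y i j (source N) = 0.
Proof.
have [s /negPf sij] := perm_avoiding i j.
have [p wp p0] := walk_perm s.
by have [] := reduced_eq0 wp (p0 i j (negbT sij)).
Qed.

Lemma y_sink i j : y i j (sink N) = 0.
Proof.
have [s /negPf sij] := perm_avoiding i j.
have [p wp p0] := walk_perm s.
by have [] := reduced_eq0 wp (p0 i j (negbT sij)).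
Qed.

(** The row weight is 1 on every source-sink walk, so every such walk is minimal and
    [potential_tight] applies to all its arcs. *)
Lemma row_props p i : walk (source N) (sink N) p ->
  [/\ row i (source N) = 0, row i (sink N) = 1 & {in p, forall a,
    row i (arc_head a) - row i (arc_tail a) = \sum_j reduced a i j}].
Proof.
move=> wp; have [|s0 t1 tight] := potential_tight _ wp (walk_row wp i).
  by move=> q wq; rewrite walk_row.
split=> [||a ap]; rewrite /row.
- by rewrite s0 big1 ?subr0 // => j _; apply: y_source.
- by rewrite t1 big1 ?subr0 // => j _; apply: y_sink.
by rewrite sumrB sumrB tight //; ring.
Qed.

Lemma col_props p j : walk (source N) (sink N) p ->
  [/\ col j (source N) = 0, col j (sink N) = 1 & {in p, forall a,
    col j (arc_head a) - col j (arc_tail a) = \sum_i reduced a i j}].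
Proof.
move=> wp; have [|s0 t1 tight] := potential_tight _ wp (walk_col wp j).
  by move=> q wq; rewrite walk_col.
split=> [||a ap]; rewrite /col.
- by rewrite s0 big1 ?subr0 // => i _; apply: y_source.
- by rewrite t1 big1 ?subr0 // => i _; apply: y_sink.
by rewrite sumrB sumrB tight //; ring.
Qed.

Definition row_support v := [set i | 0 < row i v].
Definition col_support v := [set j | 0 < col j v].

(** The last clause determines [s] from [a] alone on the rows first touched by [a]. *)
Definition crosses h (a : arc N) (s : {perm 'I_n}) :=
  [&& (#|row_support (arc_tail a)| < h <= #|row_support (arc_head a)|)%N,
    row_support (arc_tail a) \subset row_support (arc_head a),
    [forall i, (s i \in col_support (arc_tail a)) == (i \in row_support (arc_tail a))],
    [forall i, (s i \in col_support (arc_head a)) == (i \in row_support (arc_head a))] &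
    [forall i, (i \notin row_support (arc_tail a)) ==>
      (i \in row_support (arc_head a)) ==>
      [forall j, (0 < reduced a i j) == (j == s i)]]].

(** On a walk of [s] only the entries (i, s i) carry reduced weight, so row i and column s i grow
    together from 0 to 1. The number of touched rows goes from 0 to [n], and the arc sought is one
    where it first reaches [h]. *)
Lemma perm_crosses h s : (0 < h <= n)%N -> exists a, crosses h a s.
Proof.
move=> /andP[h_gt0 hn]; have [p wp p0] := walk_perm s.
have red0 a i j : a \in p -> j != s i -> reduced a i j = 0.
  by move=> ap /(p0 i j)/(reduced_eq0 wp)[_ _]; apply.
have row_step a i : a \in p ->
    row i (arc_head a) = row i (arc_tail a) + reduced a i (s i).
  move=> ap; have [_ _ /(_ a ap)] := row_props i wp.
  rewrite (bigD1 (s i)) //= big1 ?addr0 => [|j js]; last exact: red0.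
  by move=> <-; ring.
have col_step a i : a \in p ->
    col (s i) (arc_head a) = col (s i) (arc_tail a) + reduced a i (s i).
  move=> ap; have [_ _ /(_ a ap)] := col_props (s i) wp.
  rewrite (bigD1 i) //= big1 ?addr0 => [|k ki].
    by move=> <-; ring.
  by apply: red0 => //; rewrite (inj_eq perm_inj) eq_sym.
have inv : {in p, forall a,
    (forall i, row i (arc_tail a) = col (s i) (arc_tail a) /\ 0 <= row i (arc_tail a)) /\
    (forall i, row i (arc_head a) = col (s i) (arc_head a) /\ 0 <= row i (arc_head a))}.
  apply: (walk_ind (P := fun v => forall i, row i v = col (s i) v /\ 0 <= row i v) wp).
    move=> i; have [-> _ _] := row_props i wp.
    by have [-> _ _] := col_props (s i) wp.
  move=> a ap H i; have [e ge0] := H i; rewrite row_step // col_step // e.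
  by split=> //; rewrite -e addr_ge0 // (reduced_ge0 _ _ wp).
have [||a ap /andP[]] := walk_first (P := fun v => (h <= #|row_support v|)%N) wp.
- rewrite -ltnNge (_ : row_support _ = finset.set0) ?cards0 //.
  by apply/setP => i; rewrite !inE; have [-> _ _] := row_props i wp; rewrite ltxx.
- rewrite (_ : row_support _ = finset.setT) ?cardsT ?card_ord //.
  by apply/setP => i; rewrite !inE; have [_ -> _] := row_props i wp; rewrite ltr01.
rewrite -ltnNge => ltah leah; exists a; have [invt invh] := inv a ap.
apply/and5P; split.
- by rewrite ltah.
- apply/fintype.subsetP => i; rewrite !inE => /lt_le_trans; apply.
  by rewrite row_step // lerDl (reduced_ge0 _ _ wp).
- by apply/forallP => i; rewrite !inE; have [-> _] := invt i.
- by apply/forallP => i; rewrite !inE; have [-> _] := invh i.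
apply/forallP => i; apply/implyP; rewrite !inE -leNgt => le0.
apply/implyP; rewrite row_step // => gt0; apply/forallP => j.
have [->|js] := eqVneq j (s i); first by apply/eqP; lra.
by rewrite red0 // ltxx.
Qed.

(** Only two blocks of rows remain free: at most h - 1 touched at the tail, and at most n - h
    untouched at the head. Each block has a prescribed image set, and the rows between have
    prescribed images. *)
Lemma card_crosses h a : (0 < h <= n)%N ->
  (#|[set s | crosses h a s]| <= h.-1`! * (n - h)`!)%N.
Proof.
move=> /andP[h_gt0 hn].
have [->|[s0]] := set_0Vmem [set s | crosses h a s]; first by rewrite cards0.
rewrite inE => /and5P[/andP[lth leh] sub _ _ _].
set A := row_support (arc_tail a) in lth sub *.
set B := ~: row_support (arc_head a).
have cardB : (#|B| <= n - h)%N.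
  by have := cardsC (row_support (arc_head a)); rewrite card_ord -/B; lia.
apply: leq_trans (leq_mul (leq_fact (_ : #|A| <= _)%N) (leq_fact cardB)); last by lia.
apply: (card_perms_prescribed (A' := col_support (arc_tail a))
  (B' := ~: col_support (arc_head a))).
- by rewrite finset.disjoints_subset finset.setCK.
- by move=> s; rewrite inE => /and5P[_ _ /forallP H _ _] i; apply/eqP.
- move=> s; rewrite inE => /and5P[_ _ _ /forallP H _] i.
  by rewrite !finset.in_setC (eqP (H i)).
move=> s t; rewrite !inE => /and5P[_ _ _ _ /forallP Hs] /and5P[_ _ _ _ /forallP Ht].
move=> i iA; rewrite finset.in_setC negbK => iB.
move: (Hs i) (Ht i); rewrite iA iB /= => /forallP/(_ (s i)) + /forallP/(_ (s i)).
by rewrite eqxx => /eqP -> /eqP/esym/eqP.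
Qed.

Lemma fact_le_arcs h : (0 < h <= n)%N ->
  (n`! <= #|arc N| * (h.-1`! * (n - h)`!))%N.
Proof.
move=> hn; have -> : (n`! = #|[set: {perm 'I_n}]|)%N.
  by rewrite cardsT card_Sn.
have -> : [set: {perm 'I_n}] = \bigcup_(a : arc N) [set s | crosses h a s].
  apply/setP => s; rewrite inE; apply/esym/bigcupP.
  by have [a ha] := perm_crosses s hn; exists a; rewrite ?inE.
apply: (@leq_trans (\sum_(a : arc N) #|[set s | crosses h a s]|)).
  apply: (big_ind2 (fun (A : {set {perm 'I_n}}) m => #|A| <= m)%N) => //.
    by rewrite cards0.
  move=> A k B m Ak Bm; apply: leq_trans (leq_add Ak Bm).
  exact: leq_of_leqif (leq_card_setU A B).
by rewrite -sum_nat_const leq_sum // => a _; apply: card_crosses.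
Qed.

End Counting.

(** * Flows carried by walks, and walks in the support of a flow *)

Section WalkFlow.
Variables (R : realType) (N : network).
Implicit Types (phi : {ffun arc N -> R^o}) (k : R) (v : node N) (p : seq (arc N)).

Definition net_outflow phi v :=
  flow_sum phi (leaving v) - flow_sum phi (entering v).

Lemma net_outflowE phi v : net_outflow phi v =
  \sum_a phi a * ((arc_tail a == v)%:R - (arc_head a == v)%:R).
Proof.
rewrite /net_outflow /flow_sum big_mkcond [X in _ - X]big_mkcond -sumrB.
apply: eq_bigr => a _; rewrite !inE.
by case: eqP; case: eqP => _ _; rewrite ?subr0 ?sub0r ?subrr ?mulr1 ?mulr0 ?mulrN1.
Qed.

Lemma net_outflow_lin c d phi psi v :
  net_outflow (c *: phi + d *: psi) v = c * net_outflow phi v + d * net_outflow psi v.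
Proof.
rewrite !net_outflowE !mulr_sumr -big_split; apply: eq_bigr => a _ /=.
by rewrite !ffunE -![_ *: _]/(_ * _); ring.
Qed.

Lemma flow_polyhedronP k phi : flow_polyhedron N k phi <->
  (forall v, v != sink N -> net_outflow phi v = k * (v == source N)%:R) /\
  (forall a, 0 <= phi a :> R).
Proof.
split=> [[cons src pos]|[net pos]].
  split=> // v vt; have [->|vs] := eqVneq v (source N); first by rewrite mulr1.
  by rewrite mulr0; apply: cons.
split=> [v vs vt| |] //; first by have := net v vt; rewrite (negPf vs) mulr0.
by have := net (source N); rewrite eqxx mulr1 eq_sym sink_neq_source; apply.
Qed.

Definition unit_flow (a : arc N) : {ffun arc N -> R^o} := [ffun b => (b == a)%:R].

(** Arcs are counted with multiplicity, since the network may have cycles and a walk may repeat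
    arcs. *)
Definition walk_flow k p : {ffun arc N -> R^o} := \sum_(a <- p) k *: unit_flow a.

Lemma walk_flowE k p a : walk_flow k p a = k * (count_mem a p)%:R.
Proof.
rewrite /walk_flow; elim: p => [|b p IH]; first by rewrite big_nil ffunE mulr0.
rewrite big_cons ffunE IH !ffunE /= natrD mulrDr -[_ *: _]/(_ * _).
by rewrite (eq_sym a).
Qed.

Lemma walk_flow_sum k p (g : arc N -> R) :
  \sum_a walk_flow k p a * g a = k * \sum_(a <- p) g a.
Proof.
elim: p => [|b p IH].
  by rewrite big_nil mulr0 big1 // => a _; rewrite walk_flowE mulr0 mul0r.
rewrite big_cons mulrDr -IH -[k * g b](_ : \sum_a k * (b == a)%:R * g a = _).
  by rewrite -big_split; apply: eq_bigr => a _; rewrite !walk_flowE /= natrD; ring.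
rewrite (bigD1 b) //= eqxx mulr1 big1 ?addr0 // => a /negPf ab.
by rewrite eq_sym ab mulr0 mul0r.
Qed.

Lemma walk_flow_in k p : 0 < k -> walk (source N) (sink N) p ->
  flow_polyhedron N k (walk_flow k p).
Proof.
move=> k0 wp; apply/flow_polyhedronP; split=> [v vt|a]; last first.
  by rewrite walk_flowE mulr_ge0 // ltW.
rewrite net_outflowE walk_flow_sum; congr (_ * _).
(* Up to the factor [-k], the net outflow at [v] is the telescoping sum of the indicator of [v]. *)
have := walk_telescope (fun x => (x == v)%:R : R) wp.
rewrite (eq_sym (sink N)) (negPf vt) (eq_sym (source N)) sub0r => e.
by apply: oppr_inj; rewrite -e -sumrN; apply: eq_bigr => a _; ring.
Qed.

(* Otherwise the nodes reachable through the support form a set containing the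
   source but not the sink, which no flow leaves. *)
Lemma support_walk k phi : 0 < k -> flow_polyhedron N k phi ->
  exists2 p, walk (source N) (sink N) p & {in p, forall a, 0 < phi a :> R}.
Proof.
move=> k0 /flow_polyhedronP[net pos].
pose P v := `[<exists2 p, walk (source N) v p & {in p, forall a, 0 < phi a :> R}>].
have [/asboolP//|Pt] := boolP (P (sink N)).
have Ps : P (source N) by apply/asboolP; exists [::] => //=.
have : k <= 0; last by rewrite leNgt k0.
have <- : \sum_(v | P v) net_outflow phi v = k.
  rewrite (bigD1 (source N)) //= big1 => [|v /andP[Pv /negPf vs]].
    by rewrite addr0 net ?eqxx ?mulr1 // eq_sym sink_neq_source.
  by rewrite net ?vs ?mulr0 //; apply: contraNneq Pt => <-.
have indic x : \sum_(v | P v) (x == v)%:R = (P x)%:R :> R.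
  rewrite big_mkcond (bigD1 x) //= eqxx big1 ?addr0 => [|v /negPf vx].
    by case: (P x).
  by rewrite eq_sym vx; case: (P v).
under eq_bigr do rewrite net_outflowE.
rewrite exchange_big /=; apply: sumr_le0 => a _.
rewrite -mulr_sumr sumrB !indic.
have [/asboolP[p wp pp]|_] := boolP (P (arc_tail a)); last first.
  by rewrite sub0r mulrN oppr_le0 mulr_ge0.
have [a0|] := ltP 0 (phi a); last first.
  by move=> a0; have -> : phi a = 0 by [apply/eqP; rewrite eq_le a0 pos]; rewrite mul0r.
have -> : P (arc_head a) = true; last by rewrite subrr mulr0.
apply/asboolP; exists (p ++ [:: a]).
  by apply/walk_cat; exists (arc_tail a); rewrite //= !eqxx.
by move=> b; rewrite mem_cat => /orP[/pp|/[!inE]/eqP->].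
Qed.

Lemma positive_lower_bound (I : eqType) (f : I -> R) (s : seq I) :
  {in s, forall i, 0 < f i} -> exists2 d, 0 < d & {in s, forall i, d <= f i}.
Proof.
elim: s => [|x s IH] f0; first by exists 1.
have [i si|d d0 ds] := IH; first by apply: f0; rewrite inE si orbT.
exists (Num.min d (f x)); first by rewrite lt_min d0 f0 ?mem_head.
move=> i; rewrite inE ge_min => /predU1P[->|/ds->//].
by rewrite lexx orbT.
Qed.

(* The flow is a proper convex combination of the flow of the walk and of
   another point of the polyhedron. *)
Lemma support_walk_face k phi p (f : {ffun arc N -> R^o} -> R) :
  0 < k -> flow_polyhedron N k phi -> walk (source N) (sink N) p ->
  {in p, forall a, 0 < phi a :> R} ->
  (forall c d x z, f (c *: x + d *: z) = c * f x + d * f z) ->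
  (forall x, flow_polyhedron N k x -> 0 <= f x) -> f phi = 0 ->
  f (walk_flow k p) = 0.
Proof.
move=> k0 Qphi wp pp flin fpos f0.
have Qp := walk_flow_in k0 wp.
have [d d0 dp] := positive_lower_bound pp.
(* [m] bounds the walk flow on each arc, and [e * m <= d] keeps [phi] minus [e] times the walk flow
   nonnegative. The summand 1 in the denominator of [e] gives [e < 1], so that [psi] can be solved
   from phi = (1 - e) psi + e walk_flow. *)
pose m : R := k * (size p)%:R.
have m0 : 0 <= m by rewrite mulr_ge0 // ltW.
pose e := d / (d + m + 1).
have D0 : 0 < d + m + 1 by lra.
have e0 : 0 < e by rewrite divr_gt0.
have e1 : 0 < 1 - e by rewrite subr_gt0 ltr_pdivrMr //; lra.
have em : e * m <= d.
  by rewrite /e mulrAC ler_pdivrMr // ler_pM2l //; lra.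
pose psi := (1 - e)^-1 *: phi + (- (e / (1 - e))) *: walk_flow k p.
have Qpsi : flow_polyhedron N k psi.
  have /flow_polyhedronP[net pos] := Qphi; have /flow_polyhedronP[pnet _] := Qp.
  apply/flow_polyhedronP; split=> [v vt|a].
    by rewrite net_outflow_lin net // pnet //; field; lra.
  rewrite !ffunE -![_ *: _]/(_ * _) walk_flowE.
  have -> : (1 - e)^-1 * phi a + - (e / (1 - e)) * (k * (count_mem a p)%:R)
      = (phi a - e * (k * (count_mem a p)%:R)) / (1 - e) by field; lra.
  rewrite divr_ge0 ?(ltW e1) // subr_ge0.
  have [ap|/count_memPn ->] := boolP (a \in p); last by rewrite !mulr0.
  apply: le_trans (le_trans em (dp a ap)).
  by rewrite ler_pM2l // ler_pM2l // ler_nat count_size.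
apply/eqP; rewrite eq_le fpos // andbT.
have := fpos _ Qpsi; rewrite flin f0 mulr0 add0r mulNr oppr_ge0.
by rewrite pmulr_rle0 // divr_gt0.
Qed.

End WalkFlow.

(** * Perfect matchings of the complete bipartite graph as permutations *)

Section CompleteBipartite.
Variables (R : realType) (n : nat).

Fact Knn_edge_subproof (i j : 'I_n) :
  [set inl i; inr j]%SET \in edge_set (Knn n).
Proof. by apply/imsetP; exists (inl i, inr j); rewrite ?inE. Qed.

Definition Knn_edge (i j : 'I_n) : edge (Knn n) :=
  exist _ [set inl i; inr j]%SET (Knn_edge_subproof i j).

Lemma in_Knn_edgel i j i' : (inl i' \in val (Knn_edge i j)) = (i' == i).
Proof. by rewrite !inE orbF. Qed.

Lemma in_Knn_edger i j j' : (inr j' \in val (Knn_edge i j)) = (j' == j).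
Proof. by rewrite !inE. Qed.

Lemma eq_Knn_edge i j i' j' :
  (Knn_edge i j == Knn_edge i' j') = (i == i') && (j == j').
Proof.
apply/eqP/andP => [e|[/eqP-> /eqP->]//].
by rewrite -(in_Knn_edgel i' j') -(in_Knn_edger i' j') -e in_Knn_edgel in_Knn_edger.
Qed.

Lemma Knn_edgeP (e : edge (Knn n)) : exists i j, e = Knn_edge i j.
Proof.
have /imsetP[[u v]] := valP e; rewrite inE.
case: u v => [i|j] [i'|j'] //= _ ev; [exists i, j'|exists i', j]; apply: val_inj => //.
by apply: etrans ev _; exact: finset.setUC.
Qed.

Definition perm_matching (s : {perm 'I_n}) : {set edge (Knn n)} :=
  [set Knn_edge i (s i) | i : 'I_n].

Lemma in_perm_matching s i j : (Knn_edge i j \in perm_matching s) = (j == s i).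
Proof.
apply/imsetP/eqP => [[i' _ /eqP]|->]; last by exists i.
by rewrite eq_Knn_edge => /andP[/eqP<- /eqP].
Qed.

Lemma perm_matching_perfect s : perfect_matching (perm_matching s).
Proof.
case=> [i|j]; apply/eqP/cards1P.
  exists (Knn_edge i (s i)); apply/setP => e.
  have [i' [j' ->]] := Knn_edgeP e.
  rewrite 2!inE in_perm_matching in_Knn_edgel eq_Knn_edge (eq_sym i').
  by rewrite andbC; case: eqP => [->|//].
exists (Knn_edge (s^-1%g j) j); apply/setP => e.
have [i' [j' ->]] := Knn_edgeP e.
rewrite 2!inE in_perm_matching in_Knn_edger eq_Knn_edge (eq_sym j').
have [<-|_] := eqVneq j j'; rewrite ?andbT ?andbF //.
by rewrite -(inj_eq (@perm_inj _ s) i') permKV eq_sym.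
Qed.

(** The Birkhoff polytope in edge coordinates, serving as an outer description of the matching
    polytope. *)
Definition doubly_stochastic : set {ffun edge (Knn n) -> R^o} :=
  [set x | [/\ forall e, 0 <= x e :> R,
    forall i, \sum_j x (Knn_edge i j) = 1 &
    forall j, \sum_i x (Knn_edge i j) = 1]]%classic.

(** [g] enumerates the edges at [v]; stated this way it serves both rows and columns. *)
Lemma sum_incidence (M : {set edge (Knn n)}) (g : 'I_n -> edge (Knn n))
    (v : vertex (Knn n)) : injective g ->
  (forall e : edge (Knn n), v \in val e <-> exists i, e = g i) ->
  perfect_matching M ->
  \sum_i incidence R M (g i) = 1.
Proof.
move=> g_inj vg /(_ v) Mv; have Mg : #|[set i | g i \in M]| = 1%N.
  rewrite -Mv -(card_imset _ g_inj); apply: eq_card => e; rewrite !inE.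
  apply/imsetP/andP => [[i]|[eM /vg[i ei]]].
    by rewrite inE => gM ->; split=> //; apply/vg; exists i.
  by exists i; rewrite // inE -ei.
rewrite -[RHS]/(1%:R) -Mg -sum1_card natr_sum [RHS]big_mkcond; apply: eq_bigr => i _.
by rewrite ffunE inE; case: ifP.
Qed.

Lemma perfect_matching_doubly_stochastic M :
  perfect_matching M -> doubly_stochastic (incidence R M).
Proof.
move=> pM; split=> [e|i|j]; first by rewrite ffunE.
- apply: (sum_incidence (v := inl i)) pM => [j j' /eqP|e].
    by rewrite eq_Knn_edge => /andP[_ /eqP].
  have [i' [j ->]] := Knn_edgeP e; rewrite in_Knn_edgel.
  split=> [/eqP ->|[j' /eqP]]; first by exists j.
  by rewrite eq_Knn_edge eq_sym => /andP[].
- apply: (sum_incidence (v := inr j)) pM => [i i' /eqP|e].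
    by rewrite eq_Knn_edge => /andP[/eqP].
  have [i [j' ->]] := Knn_edgeP e; rewrite in_Knn_edger.
  split=> [/eqP ->|[i' /eqP]]; first by exists i.
  by rewrite eq_Knn_edge (eq_sym j') => /andP[].
Qed.

Lemma doubly_stochastic_convex : convex_set doubly_stochastic.
Proof.
move=> x z t /set_mem[x0 xr xc] /set_mem[z0 zr zc]; apply/mem_set.
have tE e : (conv t x z : {ffun edge (Knn n) -> R^o}) e
    = (t%:num * x e + (1 - t%:num) * z e)%R by rewrite !ffunE.
split=> [e|i|j].
- by rewrite tE addr_ge0 // mulr_ge0 // subr_ge0.
- under eq_bigr do rewrite tE.
  by rewrite big_split -!mulr_sumr /= xr zr; ring.
- under eq_bigr do rewrite tE.
  by rewrite big_split -!mulr_sumr /= xc zc; ring.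
Qed.

Lemma perfect_matching_polytope_sub x :
  perfect_matching_polytope R (Knn n) x -> doubly_stochastic x.
Proof.
apply: (smallest_sub doubly_stochastic_convex) => _ [M pM <-].
exact: perfect_matching_doubly_stochastic.
Qed.

End CompleteBipartite.

(** * The size bound for extensions *)

Lemma flow_extension_arcs (R : realType) (n h : nat) (N : network) (k : R) :
  (1 < n)%N -> (0 < h <= n)%N ->
  flow_extension N k (perfect_matching_polytope R (Knn n)) ->
  (n`! <= #|arc N| * (h.-1`! * (n - h)`!))%N.
Proof.
move=> n1 hn [k0 [f fQ]].
have stoch x : flow_polyhedron N k x -> doubly_stochastic (f x).
  by move=> Qx; apply: perfect_matching_polytope_sub; rewrite -fQ; exists x.
pose w (a : arc N) (i j : 'I_n) : R := f (k *: unit_flow R a) (Knn_edge i j).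
have wE p i j : \sum_(a <- p) w a i j = f (walk_flow k p) (Knn_edge i j).
  by rewrite linear_sum sum_ffunE.
apply: (@fact_le_arcs R N n w n1) hn => [p wp i j|p wp i|p wp j|s].
- by rewrite wE; have [] := stoch _ (walk_flow_in k0 wp).
- rewrite exchange_big; under eq_bigr do rewrite wE.
  by have [] := stoch _ (walk_flow_in k0 wp).
- rewrite exchange_big; under eq_bigr do rewrite wE.
  by have [] := stoch _ (walk_flow_in k0 wp).
have [phi Qphi fphi] : exists2 phi, flow_polyhedron N k phi
    & f phi = incidence R (perm_matching s).
  have : perfect_matching_polytope R (Knn n) (incidence R (perm_matching s)).
    by apply: sub_gen_smallest; exists (perm_matching s) => //; apply: perm_matching_perfect.
  by rewrite -fQ => -[phi]; exists phi.
(* The coordinate of an edge outside the matching is nonnegative on the polyhedron and zero at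
   [phi], hence zero at the flow of any walk in the support of [phi]. *)
have [p wp pp] := support_walk k0 Qphi; exists p => // i j /negPf js; rewrite wE.
apply: (support_walk_face (f := fun x => f x (Knn_edge i j)) k0 Qphi wp pp).
- by move=> c d x z; rewrite linearD !linearZ !ffunE.
- by move=> x /stoch[].
by rewrite fphi ffunE in_perm_matching js.
Qed.

Lemma flow_extension_size (R : realType) (n : nat) (N : network) (k : R) :
  (1 < n)%N -> flow_extension N k (perfect_matching_polytope R (Knn n)) ->
  4^-1 * (2 ^+ n / Num.sqrt n%:R) <= (network_size N)%:R :> R.
Proof.
case: n => // n n1 ext.
(* This [h] makes h - 1 and n - h the two halves in [leq_exp2_fact], so the number of arcs is at
   least a quarter of the power of 2. *)
have /flow_extension_arcs/(_ ext) : (0 < (n.+1 %/ 2).+1 <= n.+1)%N by lia.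
move=> /(_ n1); have -> : (n.+1 - (n.+1 %/ 2).+1 = n %/ 2)%N by lia.
rewrite /= => arcs.
set d := ((n.+1 %/ 2)`! * (n %/ 2)`!)%N in arcs.
have d0 : (0 < d)%N by rewrite muln_gt0 !fact_gt0.
have : (2 ^ n.+1 * d <= 4 * #|arc N| * d)%N.
  apply: leq_trans (leq_exp2_fact n) _.
  by rewrite -mulnA leq_mul2l arcs.
rewrite leq_pmul2r // -(ler_nat R) natrX natrM => size_ge.
(* Dividing by the square root only weakens the bound already obtained. *)
have sqrt_ge1 : 1 <= Num.sqrt n.+1%:R :> R.
  by rewrite -[leLHS]sqrtr1 ler_sqrt ?ler1n ?ltr0n.
rewrite mulrC ler_pdivrMr //; apply: le_trans (_ : 2 ^+ n.+1 <= _).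
  by rewrite ler_pdivrMr ?ler_peMr ?exprn_ge0 // (lt_le_trans ltr01).
by rewrite mulrC.
Qed.

Theorem theorem6 (R : realType) :
  exists C : R, 0 < C /\
  exists n0 : nat, forall n : nat, (n0 <= n)%N ->
    (forall (N : network) (k : R),
       flow_extension N k (perfect_matching_polytope R (Knn n)) ->
       C * (2 ^+ n / Num.sqrt n%:R) <= (network_size N)%:R) /\
    (forall N : network,
       path_extension N (perfect_matching_polytope R (Knn n)) ->
       C * (2 ^+ n / Num.sqrt n%:R) <= (network_size N)%:R).
Proof.
exists 4^-1; split; first by rewrite invr_gt0.
(* The threshold 2 supplies [1 < n]; a path extension is the case of flow value 1. *)
exists 2 => n n1; split=> [N k|N [_]]; exact: flow_extension_size.
Qed.
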